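(* Let $\mathbf{k}$ be a commutative unitary ring, $\lambda\in\mathbf{k}$, and let $A_\lambda=\bigoplus_{m\ge0}\mathbf{k}\,\mathfrak{a}_m$ be the Rota-Baxter algebra of weight $\lambda$ described in the context. (1) Let $I$ be a homogeneous Rota-Baxter ideal of $A_\lambda$ with ascent set $A(I)=\{(s_j,\Omega_{s_j})\mid j\in[N_I]\}$. Then, with the convention that $s_{N_I+1}=\infty$ if $N_I$ is finite, $$I=\bigoplus_{i=s_1}^{\infty}\Omega_i\,\mathfrak{a}_i=\bigoplus_{j=1}^{N_I}\ \bigoplus_{i=s_j}^{s_{j+1}-1}\Omega_{s_j}\,\mathfrak{a}_i,$$ as a direct sum of the $\mathbf{k}$-modules $\Omega_{s_j}\mathfrak{a}_i$. (2) With $I$ as in (1), the quotient $A_\lambda/I$ is the direct sum of the $\mathbf{k}$-modules $(\mathbf{k}/\Omega_{s_j})\mathfrak{a}_i$, that is, $$A_\lambda/I\cong\bigoplus_{j=0}^{N_I}\ \bigoplus_{i=s_j}^{s_{j+1}-1}(\mathbf{k}/\Omega_{s_j})\,\mathfrak{a}_i,$$ with the convention that for $j=0$ one puts $s_0=0$ and $\Omega_{s_0}=0$ (so that the $j=0$ summand is $\bigoplus_{i=0}^{s_1-1}\mathbf{k}\,\mathfrak{a}_i$), and $s_{N_I+1}=\infty$ if $N_I$ is finite. (3) For any $\{(s_j,\Omega_{s_j})\}_{j\in[N]}$ in the set $\mathcal{A}$ of ascending pairs, consisting of a positive integer $N$ or $N=\infty$, strictly increasing nonnegative integers $s_j$ and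 strictly increasing ideals $\Omega_{s_j}$ of $\mathbf{k}$, $j\in[N]$, there is a unique homogeneous Rota-Baxter ideal $I$ of $A_\lambda$ such that $A(I)=\{(s_j,\Omega_{s_j})\}_{j\in[N]}$. In other words, the restriction of the map $\Phi: I\mapsto A(I)$ (from Rota-Baxter ideals of $A_\lambda$ to $\mathcal{A}$) to the set of homogeneous Rota-Baxter ideals of $A_\lambda$ is a bijection onto $\mathcal{A}$.
   Context: The algebra $A_\lambda$: as a $\mathbf{k}$-module it is free on the basis $\{\mathfrak{a}_m\mid m\ge 0\}$; the product is the $\mathbf{k}$-bilinear product determined by $$\mathfrak{a}_m\mathfrak{a}_n=\sum_{i=0}^{\min(m,n)}\binom{m+n-i}{m}\binom{m}{i}\lambda^i\,\mathfrak{a}_{m+n-i},\qquad m,n\ge 0,$$ with identity $\mathfrak{a}_0$; it carries the $\mathbf{k}$-linear operator $P$ with $P(\mathfrak{a}_m)=\mathfrak{a}_{m+1}$ for $m\ge 0$, and $(A_\lambda,P)$ is a Rota-Baxter algebra of weight $\lambda$, i.e. $P(x)P(y)=P(xP(y))+P(P(x)y)+\lambda P(xy)$ for all $x,y$. It is the initial object in the category of Rota-Baxter $\mathbf{k}$-algebras of weight $\lambda$. A Rota-Baxter ideal of $A_\lambda$ (also called a Rota-Baxter characteristic) is an ideal $I$ of the algebra $A_\lambda$ with $P(I)\subseteq I$; the Rota-Baxter ideal generated by a subset is the smallest Rota-Baxter ideal containing it. A homogeneous element is one of the form $b\,\mathfrak{a}_m$ with $b\in\mathbf{k}$, $m\ge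 0$; a homogeneous Rota-Baxter ideal (homogeneous Rota-Baxter characteristic) is a Rota-Baxter ideal generated, as a Rota-Baxter ideal, by a set of homogeneous elements. For nonzero $f=\sum_{i=0}^n c_i\mathfrak{a}_i$ with $c_n\ne 0$, the initial term of $f$ is $\mathrm{in}(f)=c_n\mathfrak{a}_n$. Ascent set: for a Rota-Baxter ideal $I$ and $j\ge 0$, let $\Omega_j=\Omega_j(I)=\{0\}\cup\{b\in\mathbf{k}\mid \exists f\in I,\ \mathrm{in}(f)=b\,\mathfrak{a}_j\}$; these are ideals of $\mathbf{k}$ with $\Omega_j\subseteq\Omega_{j+1}$. Put $\Omega_{-1}=\{0\}$ and let $s_1<s_2<\cdots$ be the integers $t\ge 0$ with $\Omega_{t-1}\subsetneq\Omega_t$, indexed by $[N_I]$ where $N_I\in\{0,1,2,\dots\}\cup\{\infty\}$ is their number. Here $[n]=\{1,\dots,n\}$ and $[\infty]$ is the set of positive integers. The ascent set is $A(I)=\{(s_j,\Omega_{s_j})\mid j\in[N_I]\}$. When $N_I=\infty$, the sums over $j$ run over all integers $j\ge 1$ (resp. $j\ge 0$); an upper limit $s_{j+1}-1$ with $s_{j+1}=\infty$ means that $i$ runs over all integers $\ge s_j$. The set of ascending pairs $\mathcal{A}$ consists of all $\{(s_j,\Omega_{s_j})\}_{j\in[N]}$ with $1\le N\le\infty$, where the $s_j$ are nonnegative integers, the $\Omega_{s_j}$ are ideals of $\mathbf{k}$, and $s_j<s_{j+1}$ and $\Omega_{s_j}\subsetneq\Omega_{s_{j+1}}$ for all consecutive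 indices $j,j+1\in[N]$.
   Formalization: In (3) ascending pairs are also required to have a nonzero first ideal Ω_{s_1} (no ascent set has Ω_{s_1}=0, e.g. {(0,0)}), and the bijection Φ is taken on nonzero homogeneous Rota-Baxter ideals, since A(0) is empty and not in the set of ascending pairs. *)

(* Defs.v *)
From HB Require Import structures.
From mathcomp Require Import all_boot all_order all_algebra.
From mathcomp Require Import finmap.
From mathcomp Require Import mathcomp_extra boolp classical_sets functions.
From mathcomp Require Import cardinality fsbigop.
From mathcomp Require Import zify ring.

Set Implicit Arguments.
Unset Strict Implicit.
Unset Printing Implicit Defensive.

Import GRing.Theory.
#[local] Obligation Tactic := idtac.
Local Open Scope classical_set_scope.
Local Open Scope ring_scope.
Local Open Scope quotient_scope.

Record submod (k : pzRingType) (V : lmodType k) := Submod {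
  submod_set :> set V;
  submod0 : submod_set 0;
  submodP : forall (c : k) (x y : V),
    submod_set x -> submod_set y -> submod_set (c *: x + y) }.

Definition submod_pred (k : pzRingType) (V : lmodType k) (S : submod V) :
  V -> Prop := submod_set S.
Coercion submod_pred : submod >-> Funclass.

Notation ideal k := (submod k^o).

Section SubmodTheory.
Variables (k : pzRingType) (V : lmodType k) (S : submod V).

Lemma submodB (x y : V) : S x -> S y -> S (x - y).
Proof. by move=> Sx Sy; rewrite addrC -scaleN1r; apply: submodP. Qed.

Lemma submodZ (c : k) (x : V) : S x -> S (c *: x).
Proof. by move=> Sx; rewrite -[_ *: _]addr0; apply: submodP => //; apply: submod0. Qed.

Definition submod_mem : V -> bool := fun x => `[< S x >].

Lemma submod_mem_zmod_closed : zmod_closed submod_mem.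
Proof.
split; first exact/asboolP/submod0.
by move=> x y /asboolP Sx /asboolP Sy; apply/asboolP/submodB.
Qed.

HB.instance Definition _ :=
  GRing.isZmodClosed.Build V submod_mem submod_mem_zmod_closed.

Definition quotmod : Type := (Quotient.quot (GRing.ZmodClosed.clone V submod_mem _)).

HB.instance Definition _ := GRing.Zmodule.on quotmod.
HB.instance Definition _ :=
  EqQuotient.copy quotmod (Quotient.quot (GRing.ZmodClosed.clone V submod_mem _)).
HB.instance Definition _ :=
  ZmodQuotient.copy quotmod (Quotient.quot (GRing.ZmodClosed.clone V submod_mem _)).

Definition qpi (x : V) : quotmod := \pi_quotmod x.

Lemma qpiE (x y : V) : (qpi x = qpi y) <-> S (x - y).
Proof.
split=> [/eqP|Sxy].
  by rewrite -Quotient.idealrBE => /asboolP.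
by apply/eqP; rewrite -Quotient.idealrBE; apply/asboolP.
Qed.

Definition qscale (c : k) (q : quotmod) : quotmod := qpi (c *: repr q).

Lemma qscale_pi (c : k) (x : V) : qscale c (qpi x) = qpi (c *: x).
Proof.
apply/qpiE; rewrite -scalerBr; apply: submodZ; apply/qpiE.
by rewrite /qpi reprK.
Qed.

Lemma qpiD (x y : V) : qpi (x + y) = qpi x + qpi y.
Proof. exact: pi_addr. Qed.

Lemma qpi_surj (q : quotmod) : q = qpi (repr q).
Proof. by rewrite /qpi reprK. Qed.

Fact qscaleA (a b : k) (q : quotmod) : qscale a (qscale b q) = qscale (a * b) q.
Proof. by rewrite (qpi_surj q) !qscale_pi scalerA. Qed.

Fact qscale1 : left_id 1 qscale.
Proof. by move=> q; rewrite (qpi_surj q) qscale_pi scale1r. Qed.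

Fact qscaleDr : right_distributive qscale +%R.
Proof.
move=> c p q; rewrite (qpi_surj p) (qpi_surj q).
by rewrite -qpiD !qscale_pi -qpiD scalerDr.
Qed.

Fact qscaleDl (q : quotmod) : {morph qscale^~ q : a b / a + b}.
Proof. by move=> a b; rewrite (qpi_surj q) !qscale_pi -qpiD scalerDl. Qed.

HB.instance Definition _ :=
  GRing.Zmodule_isLmodule.Build k quotmod qscaleA qscale1 qscaleDr qscaleDl.

Fact qpi_is_linear : linear qpi.
Proof. by move=> c x y; rewrite qpiD -qscale_pi. Qed.

HB.instance Definition _ :=
  GRing.isLinear.Build k V quotmod *:%R qpi qpi_is_linear.

End SubmodTheory.

Program Definition zero_submod (k : pzRingType) (V : lmodType k) : submod V :=
  @Submod k V [set 0] _ _.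
Next Obligation. by []. Qed.
Next Obligation. by move=> k V c x y -> ->; rewrite scaler0 addr0. Qed.

Program Definition ideal_mul (k : pzRingType) (V : lmodType k)
    (J : ideal k) (x : V) : submod V :=
  @Submod k V [set c *: x | c in (J : set k)] _ _.
Next Obligation.
by move=> k V J x; exists 0; [exact: submod0 | rewrite scale0r].
Qed.
Next Obligation.
move=> k V J x c _ _ [a Ja <-] [b Jb <-]; exists (c * a + b).
  exact: (@submodP _ _ J c a b).
by rewrite scalerDl scalerA.
Qed.

Record dsum (k : pzRingType) (T : Type) (M : T -> lmodType k) := DSum {
  dsum_val :> forall t, M t;
  dsum_fin : finite_set [set t | dsum_val t <> 0] }.

Section DirectSum.
Variables (k : pzRingType) (T : Type) (M : T -> lmodType k).
Local Notation D := (dsum M).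

Lemma dsumP (x y : D) : (forall t, x t = y t) -> x = y.
Proof.
case: x y => [x fx] [y fy] /= xy.
have e : x = y by apply: functional_extensionality_dep.
by subst y; congr DSum; apply: Prop_irrelevance.
Qed.

HB.instance Definition _ := gen_eqMixin D.
HB.instance Definition _ := gen_choiceMixin D.

Program Definition dsum0 : D := @DSum _ _ M (fun t => 0) _.
Next Obligation.
by rewrite (_ : [set _ | _] = set0) //; apply/seteqP; split=> t /=.
Qed.

Program Definition dsum_opp (x : D) : D := @DSum _ _ M (fun t => - x t) _.
Next Obligation.
move=> x; apply: sub_finite_set (dsum_fin x) => t /= nz e; apply: nz.
by rewrite e oppr0.
Qed.

Program Definition dsum_add (x y : D) : D := @DSum _ _ M (fun t => x t + y t) _.
Next Obligation.
move=> x y; have f : finite_set ([set t | x t <> 0] `|` [set t | y t <> 0]).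
  by rewrite finite_setU; split; apply: dsum_fin.
apply: sub_finite_set f => t /= nz; apply: contrapT => /not_orP[].
by move=> /contrapT ex /contrapT ey; apply: nz; rewrite ex ey addr0.
Qed.

Program Definition dsum_scale (c : k) (x : D) : D :=
  @DSum _ _ M (fun t => c *: x t) _.
Next Obligation.
move=> c x; apply: sub_finite_set (dsum_fin x) => t /= nz e; apply: nz.
by rewrite e scaler0.
Qed.

Fact dsum_addA : associative dsum_add.
Proof. by move=> x y z; apply: dsumP => t /=; rewrite addrA. Qed.
Fact dsum_addC : commutative dsum_add.
Proof. by move=> x y; apply: dsumP => t /=; rewrite addrC. Qed.
Fact dsum_add0 : left_id dsum0 dsum_add.
Proof. by move=> x; apply: dsumP => t /=; rewrite add0r. Qed.
Fact dsum_addN : left_inverse dsum0 dsum_opp dsum_add.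
Proof. by move=> x; apply: dsumP => t /=; rewrite addNr. Qed.

HB.instance Definition _ :=
  GRing.isZmodule.Build D dsum_addA dsum_addC dsum_add0 dsum_addN.

Fact dsum_scaleA (a b : k) (x : D) :
  dsum_scale a (dsum_scale b x) = dsum_scale (a * b) x.
Proof. by apply: dsumP => t /=; rewrite scalerA. Qed.
Fact dsum_scale1 : left_id 1 dsum_scale.
Proof. by move=> x; apply: dsumP => t /=; rewrite scale1r. Qed.
Fact dsum_scaleDr : right_distributive dsum_scale +%R.
Proof. by move=> c x y; apply: dsumP => t /=; rewrite scalerDr. Qed.
Fact dsum_scaleDl (x : D) : {morph dsum_scale^~ x : a b / a + b}.
Proof. by move=> a b; apply: dsumP => t /=; rewrite scalerDl. Qed.

HB.instance Definition _ := GRing.Zmodule_isLmodule.Build k D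
  dsum_scaleA dsum_scale1 dsum_scaleDr dsum_scaleDl.

Definition dsum_at (t : T) (x : D) : M t := x t.
Fact dsum_at_is_linear t : linear (dsum_at t).
Proof. by []. Qed.
HB.instance Definition _ t :=
  GRing.isLinear.Build k D (M t) *:%R (dsum_at t) (dsum_at_is_linear t).

End DirectSum.

(* Internal direct sum: W consists of the finite sums of elements of the F t
   with t in D, and such a sum vanishes only if all its terms do. *)
Definition is_dsum (k : pzRingType) (V : lmodType k) (T : choiceType)
    (D : set T) (F : T -> submod V) (W : submod V) : Prop :=
  (forall x : V, W x <->
     exists f : T -> V, [/\ forall t, D t -> F t (f t),
       finite_set (D `&` [set t | f t <> 0]) & x = \sum_(t \in D) f t]) /\
  (forall f : T -> V, (forall t, D t -> F t (f t)) ->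
     finite_set (D `&` [set t | f t <> 0]) -> \sum_(t \in D) f t = 0 ->
     forall t, D t -> f t = 0).

(* The free k-module on a_0, a_1, ...; lam only selects the ring structure
   declared below. *)
Definition RB (k : comPzRingType) (lam : k) : Type :=
  dsum (fun _ : nat => k^o : lmodType k).

HB.instance Definition _ (k : comPzRingType) (lam : k) :=
  GRing.Lmodule.copy (RB lam) (dsum (fun _ : nat => k^o : lmodType k)).

Section RotaBaxter.
Variables (k : comPzRingType) (lam : k).
Local Notation A := (RB lam).

Definition coef (f : A) (i : nat) : k := dsum_val f i.

#[local] Arguments coef : simpl never.

Program Definition rba (m : nat) : A :=
  @DSum k nat (fun _ => k^o) (fun i => (i == m)%:R : k^o) _.
Next Obligation.
move=> m; apply: sub_finite_set (finite_set1 m) => i /=.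
by case: eqP.
Qed.

Lemma coefP (x y : A) : (forall i, coef x i = coef y i) -> x = y.
Proof. by move=> e; apply: (@dsumP k nat (fun _ => k^o) x y). Qed.
Lemma coef_a m i : coef (rba m) i = (i == m)%:R. Proof. by []. Qed.
Lemma coefD x y i : coef (x + y) i = coef x i + coef y i. Proof. by []. Qed.
Lemma coefZ c x i : coef (c *: x) i = c * coef x i. Proof. by []. Qed.
Lemma coef0 i : coef 0 i = 0. Proof. by []. Qed.
Lemma coef_sum (I : Type) (r : seq I) (F : I -> A) i :
  coef (\sum_(j <- r) F j) i = \sum_(j <- r) coef (F j) i.
Proof. exact: (big_morph (coef^~ i) (fun x y => coefD x y i) (coef0 i)). Qed.

Definition supp (x : A) : {fset nat} := fset_set [set i | coef x i <> 0].

Lemma coef_out x i : i \notin supp x -> coef x i = 0.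
Proof.
rewrite /supp in_fset_set; last exact: (@dsum_fin k nat (fun _ => k^o) x).
by rewrite notin_setE /= => /contrapT.
Qed.

(* The k-linear map sending each a_m to g m: see linext_a, linext_uniq. *)
Definition linext (V : lmodType k) (g : nat -> V) (x : A) : V :=
  \sum_(m \in [set: nat]) coef x m *: g m.

Lemma linextE (V : lmodType k) (g : nat -> V) x (B : {fset nat}) :
  (forall i, i \notin B -> coef x i = 0) ->
  linext g x = \sum_(m <- B) coef x m *: g m.
Proof. by move=> h; apply: fsbigTE => i /h ->; rewrite scale0r. Qed.

Fact linext_is_linear (V : lmodType k) (g : nat -> V) : linear (linext g).
Proof.
move=> c x y; pose B := (supp x `|` supp y)%fset.
have hx i : i \notin B -> coef x i = 0.
  by rewrite in_fsetU negb_or => /andP[/coef_out].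
have hy i : i \notin B -> coef y i = 0.
  by rewrite in_fsetU negb_or => /andP[_ /coef_out].
rewrite (linextE g hx) (linextE g hy) (@linextE _ _ _ B) => [|i iB].
  rewrite scaler_sumr -big_split /=; apply: eq_bigr => i _.
  by rewrite coefD coefZ scalerDl scalerA.
by rewrite coefD coefZ hx // hy // mulr0 addr0.
Qed.

HB.instance Definition _ (V : lmodType k) (g : nat -> V) :=
  GRing.isLinear.Build k A V *:%R (linext g) (linext_is_linear g).

Lemma linext_a (V : lmodType k) (g : nat -> V) m : linext g (rba m) = g m.
Proof.
rewrite (@linextE _ _ _ [fset m]%fset) ?big_seq_fset1 ?coef_a ?eqxx ?scale1r //.
by move=> i; rewrite in_fset1 coef_a => /negPf->.
Qed.

Lemma rba_expand (x : A) : x = linext rba x.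
Proof.
rewrite (@linextE _ _ _ (supp x)); last exact: coef_out.
apply: coefP => i; rewrite coef_sum.
have [ix|ix] := boolP (i \in supp x).
  rewrite (big_fsetD1 i) //= big_seq big1 ?addr0.
    by rewrite coefZ coef_a eqxx mulr1.
  move=> j; rewrite in_fsetD1 => /andP[ji _].
  by rewrite coefZ coef_a eq_sym (negPf ji) mulr0.
rewrite coef_out // big_seq big1 // => j jx.
rewrite coefZ coef_a.
by case: eqP jx ix => [<- -> | _]; rewrite ?mulr0.
Qed.

Lemma linext_uniq (V : lmodType k) (h1 h2 : {linear A -> V}) :
  (forall m, h1 (rba m) = h2 (rba m)) -> h1 =1 h2.
Proof.
move=> e x; rewrite (rba_expand x) (@linextE _ _ _ (supp x)); last exact: coef_out.
by rewrite !linear_sum; apply: eq_bigr => i _; rewrite !linearZ /= e.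
Qed.

Definition mul_basis (m n : nat) : A :=
  \sum_(i < (minn m n).+1)
    (('C(m + n - i, m) * 'C(m, i))%:R * lam ^+ i) *: rba (m + n - i).

Definition rbmul (x y : A) : A :=
  linext (fun m => linext (fun n => mul_basis m n) y) x.

Definition rbP : A -> A := linext (fun m => rba m.+1).

HB.instance Definition _ := GRing.Linear.on rbP.

Lemma rbP_a m : rbP (rba m) = rba m.+1. Proof. exact: linext_a. Qed.
Lemma rbmul_a m n : rbmul (rba m) (rba n) = mul_basis m n.
Proof. by rewrite /rbmul !linext_a. Qed.

Lemma rbmul_linl y : linear (rbmul^~ y).
Proof. by move=> c x x'; rewrite /rbmul linearP. Qed.
Lemma rbmul_linr x : linear (rbmul x).
Proof.
move=> c y y'; rewrite /rbmul !(@linextE _ _ x (supp x)); try exact: coef_out.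
rewrite scaler_sumr -big_split /=; apply: eq_bigr => i _.
by rewrite linearP scalerDr !scalerA mulrC.
Qed.
Definition mull (y x : A) := rbmul x y.
HB.instance Definition _ y :=
  GRing.isLinear.Build k A A *:%R (mull y) (rbmul_linl y).
HB.instance Definition _ x :=
  GRing.isLinear.Build k A A *:%R (rbmul x) (rbmul_linr x).

Lemma mul_basisE m n N : (minn m n < N)%N -> mul_basis m n =
  \sum_(i < N) (('C(m + n - i, m) * 'C(m, i))%:R * lam ^+ i) *: rba (m + n - i).
Proof.
move=> hN; rewrite /mul_basis (big_ord_widen _ (fun i =>
  (('C(m + n - i, m) * 'C(m, i))%:R * lam ^+ i) *: rba (m + n - i)) hN).
rewrite big_mkcond /=; apply: eq_bigr => i _; case: ifP => // /negbT hi.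
have [mi|im] := ltnP m i; first by rewrite (bin_small mi) muln0 mul0r scale0r.
by rewrite (@bin_small (m + n - i)) ?mul0n ?mul0r ?scale0r //; lia.
Qed.

Lemma rbmul1 : left_id (rba 0) rbmul.
Proof.
apply: (@linext_uniq _ (rbmul (rba 0)) idfun) => n /=.
by rewrite rbmul_a /mul_basis min0n big_ord1 subn0 add0n bin0 bin0n eqxx mulr1
  scale1r.
Qed.

Lemma mul_basisC m n : mul_basis m n = mul_basis n m.
Proof.
rewrite /mul_basis minnC; apply: eq_bigr => -[i /= hi] _.
rewrite (addnC n m); congr ((_%:R * _) *: _).
have im : (i <= m)%N by lia.
have i_n : (i <= n)%N by lia.
have h1 : ('C(m + n - i, m) * 'C(m, i) * (m`! * (n - i)`! * (i`! * (m - i)`!)) =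
  (m + n - i)`! * m`!)%N.
  have e1 := @bin_fact (m + n - i) m ltac:(lia).
  rewrite (_ : m + n - i - m = n - i)%N in e1; last by lia.
  by rewrite -e1 -[in X in _ = (_ * X)%N](bin_fact im); ring.
have h2 : ('C(m + n - i, n) * 'C(n, i) * (n`! * (m - i)`! * (i`! * (n - i)`!)) =
  (m + n - i)`! * n`!)%N.
  have e1 := @bin_fact (m + n - i) n ltac:(lia).
  rewrite (_ : m + n - i - n = m - i)%N in e1; last by lia.
  by rewrite -e1 -[in X in _ = (_ * X)%N](bin_fact i_n); ring.
have fm := fact_gt0 m; have fn := fact_gt0 n; have fi := fact_gt0 i.
have fmi := fact_gt0 (m - i); have fni := fact_gt0 (n - i).
have pp : (0 < m`! * n`! * (n - i)`! * i`! * (m - i)`!)%N by rewrite !muln_gt0 fm fn fi fmi fni.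
apply/eqP; rewrite -(eqn_pmul2r pp); apply/eqP.
transitivity ((m + n - i)`! * m`! * n`!)%N.
  by rewrite -h1; ring.
by rewrite mulnAC -h2; ring.
Qed.

Lemma rbmulC : commutative rbmul.
Proof.
move=> x y.
apply: (@linext_uniq _ (mull y) (rbmul y)) => m /=.
rewrite /mull.
apply: (@linext_uniq _ (rbmul (rba m)) (mull (rba m))) => n /=.
by rewrite /mull !rbmul_a mul_basisC.
Qed.

Lemma mul_basisS m n : mul_basis m.+1 n.+1 =
  rbP (mul_basis m n.+1) + rbP (mul_basis m.+1 n) + lam *: rbP (mul_basis m n).
Proof.
pose N := (m + n + 3)%N.
rewrite (@mul_basisE m.+1 n.+1 N.+1) ?(@mul_basisE m n.+1 N.+1)
  ?(@mul_basisE m.+1 n N.+1) ?(@mul_basisE m n N); try by rewrite /N; lia.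
rewrite !(linear_sum rbP) /= scaler_sumr.
rewrite [X in X = _]big_ord_recl [X in _ = X + _ + _]big_ord_recl.
rewrite [X in _ = _ + X + _]big_ord_recl /=.
rewrite addrACA -[RHS]addrA; congr (_ + _).
  rewrite !linearZ /= !rbP_a !subn0 !expr0 !mulr1 !bin0 !muln1 !addSn !addnS.
  by rewrite -scalerDl -natrD binS addnC.
rewrite -!big_split /=; apply: eq_bigr => -[i /= hi] _.
rewrite /bump /= add1n !linearZ /= !rbP_a scalerA.
have [im|mi] := leqP i m; last first.
  rewrite (@bin_small m.+1 i.+1) // (@bin_small m i.+1) ?(@bin_small m i) //;
    last by lia.
  by rewrite !muln0 !mul0r !scale0r !addr0.
have [i_n|ni] := leqP i n; last first.
  by rewrite !(@bin_small _ m) ?(@bin_small _ m.+1) ?mul0n ?mul0r ?mulr0 ?scale0r ?addr0 //; lia.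
have e0 : (m.+1 + n.+1 - i.+1 = (m + n - i).+1)%N by lia.
have e1 : (m + n.+1 - i.+1 = m + n - i)%N by lia.
have e2 : (m.+1 + n - i.+1 = m + n - i)%N by lia.
rewrite e0 e1 e2 -!scalerDl; congr (_ *: _).
rewrite !binS !natrM !natrD exprS; ring.
Qed.

Lemma rbP_mul x y : rbmul (rbP x) (rbP y) =
  rbP (rbmul x (rbP y)) + rbP (rbmul (rbP x) y) + lam *: rbP (rbmul x y).
Proof.
have step y' : (forall m, rbmul (rbP (rba m)) (rbP y') =
    rbP (rbmul (rba m) (rbP y')) + rbP (rbmul (rbP (rba m)) y') +
    lam *: rbP (rbmul (rba m) y')) ->
  forall x', rbmul (rbP x') (rbP y') =
    rbP (rbmul x' (rbP y')) + rbP (rbmul (rbP x') y') + lam *: rbP (rbmul x' y').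
  apply: (@linext_uniq _ (mull (rbP y') \o rbP)
    ((rbP \o mull (rbP y')) \+ (rbP \o (mull y' \o rbP)) \+
     (lam \*: (rbP \o mull y')))).
apply: step => m; rewrite rbP_a.
apply: (@linext_uniq _ (rbmul (rba m.+1) \o rbP)
    ((rbP \o (rbmul (rba m) \o rbP)) \+ (rbP \o rbmul (rba m.+1)) \+
     (lam \*: (rbP \o rbmul (rba m)))) _ y) => n /=.
by rewrite /= rbP_a !rbmul_a mul_basisS.
Qed.

Let rbmulDl x y z : rbmul (x + y) z = rbmul x z + rbmul y z.
Proof. exact: (linearD (mull z)). Qed.
Let rbmulDr x y z : rbmul x (y + z) = rbmul x y + rbmul x z.
Proof. exact: (linearD (rbmul x)). Qed.
Let rbmulZl c x z : rbmul (c *: x) z = c *: rbmul x z.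
Proof. exact: (linearZZ (mull z)). Qed.
Let rbmulZr c x z : rbmul x (c *: z) = c *: rbmul x z.
Proof. exact: (linearZZ (rbmul x)). Qed.
Let rbPD x y : rbP (x + y) = rbP x + rbP y.
Proof. exact: linearD. Qed.
Let rbPZ c x : rbP (c *: x) = c *: rbP x.
Proof. exact: (linearZZ rbP). Qed.

Let rbmul_aA m n p :
  rbmul (rba m) (rbmul (rba n) (rba p)) = rbmul (rbmul (rba m) (rba n)) (rba p).
Proof.
have [N] := ubnP (m + n + p)%N; elim: N m n p => // N IH m n p hN.
case: m hN => [|m] hN; first by rewrite !rbmul1.
case: n hN => [|n] hN; first by rewrite rbmul1 (rbmulC _ (rba 0)) rbmul1.
case: p hN => [|p] hN; first by rewrite !(rbmulC _ (rba 0)) !rbmul1.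
rewrite -!rbP_a; set a := rba m; set b := rba n; set c := rba p.
have E1 : rbmul a (rbmul (rbP b) (rbP c)) = rbmul (rbmul a (rbP b)) (rbP c).
  by rewrite !rbP_a; apply: IH; lia.
have E2 : rbmul (rbP a) (rbmul b (rbP c)) = rbmul (rbmul (rbP a) b) (rbP c).
  by rewrite !rbP_a; apply: IH; lia.
have E3 : rbmul (rbP a) (rbmul (rbP b) c) = rbmul (rbmul (rbP a) (rbP b)) c.
  by rewrite !rbP_a; apply: IH; lia.
have E4 : rbmul a (rbmul b (rbP c)) = rbmul (rbmul a b) (rbP c).
  by rewrite !rbP_a; apply: IH; lia.
have E5 : rbmul a (rbmul (rbP b) c) = rbmul (rbmul a (rbP b)) c.
  by rewrite !rbP_a; apply: IH; lia.
have E6 : rbmul (rbP a) (rbmul b c) = rbmul (rbmul (rbP a) b) c.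
  by rewrite !rbP_a; apply: IH; lia.
have E7 : rbmul a (rbmul b c) = rbmul (rbmul a b) c by apply: IH; lia.
have G x u v w : rbmul (rbP x) (rbP u + rbP v + lam *: rbP w) =
    rbP (rbmul x (rbP u + rbP v + lam *: rbP w)) +
    (rbP (rbmul (rbP x) u) + rbP (rbmul (rbP x) v) + lam *: rbP (rbmul (rbP x) w)) +
    lam *: (rbP (rbmul x u) + rbP (rbmul x v) + lam *: rbP (rbmul x w)).
  rewrite !(rbmulDr, rbmulZr) !rbP_mul !(rbPD, rbPZ, scalerDr).
  by apply: coefP => i; rewrite !(coefD, coefZ); ring.
rewrite [in RHS]rbmulC {1}[rbmul (rbP b) (rbP c)]rbP_mul G -[in LHS]rbP_mul.
rewrite [rbmul (rbP a) (rbP b)]rbP_mul G -[in RHS]rbP_mul.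
rewrite ![rbmul c _]rbmulC ![rbmul (rbP c) _]rbmulC E1 E2 E3 E4 E5 E6 E7.
by apply: coefP => i; rewrite !(coefD, coefZ); ring.
Qed.

Fact rbmulA : associative rbmul.
Proof.
move=> x y z.
apply: (@linext_uniq _ (mull (rbmul y z)) (mull z \o mull y)) => m /=; rewrite /mull.
apply: (@linext_uniq _ (rbmul (rba m) \o mull z) (mull z \o rbmul (rba m))) => n /=.
rewrite /mull.
apply: (@linext_uniq _ (rbmul (rba m) \o rbmul (rba n))
  (rbmul (rbmul (rba m) (rba n)))) => p /=.
exact: rbmul_aA.
Qed.

HB.instance Definition _ := GRing.Zmodule_isComPzRing.Build A
  rbmulA rbmulC rbmul1 rbmulDl.

Lemma rba0 : rba 0 = 1 :> A. Proof. by []. Qed.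

Lemma rbaM m n : rba m * rba n = \sum_(i < (minn m n).+1)
  (('C(m + n - i, m) * 'C(m, i))%:R * lam ^+ i) *: rba (m + n - i) :> A.
Proof. exact: rbmul_a. Qed.

(* RB lam is not declared as an algType, which would require 1 <> 0 in k. *)
Lemma rb_scalerAl (c : k) (x y : A) : c *: (x * y) = (c *: x) * y.
Proof. by rewrite -[RHS]/(rbmul _ _) rbmulZl. Qed.

End RotaBaxter.

Record rb_ideal (k : comPzRingType) (lam : k) := RBIdeal {
  rbi_submod :> submod (RB lam);
  rbi_mul : forall x y : RB lam, rbi_submod y -> rbi_submod (x * y);
  rbi_P : forall x : RB lam, rbi_submod x -> rbi_submod (rbP x) }.

Section RBIdeals.
Variables (k : comPzRingType) (lam : k).
Local Notation A := (RB lam).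

Definition rb_generated (G : set A) (I : rb_ideal lam) : Prop :=
  G `<=` submod_set I /\
  forall J : rb_ideal lam, G `<=` submod_set J -> submod_set I `<=` submod_set J.

Definition homogeneous_elt (x : A) : Prop :=
  exists (b : k) (m : nat), x = b *: rba lam m.

Definition homogeneous (I : rb_ideal lam) : Prop :=
  exists G : set A, (forall x, G x -> homogeneous_elt x) /\ rb_generated G I.

(* deg 0 = 0 and in_term 0 = 0 are junk values. *)
Definition deg (f : A) : nat :=
  \big[maxn/0%N]_(i \in [set i | coef f i <> 0]) i.

Definition in_term (f : A) : A := coef f (deg f) *: rba lam (deg f).

Lemma degE f : deg f = (\max_(i <- supp f) i)%N.
Proof. by rewrite /deg fsbig_finite //; exact: (@dsum_fin k nat (fun _ => k^o) f). Qed.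

Lemma supp_in (f : A) i : (i \in supp f) <-> coef f i <> 0.
Proof.
rewrite /supp in_fset_set; last exact: (@dsum_fin k nat (fun _ => k^o) f).
by split; [move/set_mem | move=> h; apply/mem_set].
Qed.

Lemma coef_gt_deg f i : (deg f < i)%N -> coef f i = 0.
Proof.
move=> h; apply: contrapT => /supp_in hi; move: h.
by rewrite degE ltnNge (@leq_bigmax_seq _ _ xpredT (fun i => i) i).
Qed.

Lemma coef_deg f : f <> 0 -> coef f (deg f) <> 0.
Proof.
move=> f0; apply/supp_in; rewrite degE.
have : supp f != [::] :> seq nat.
  apply/eqP => e; apply: f0; apply: coefP => i; apply: coef_out.
  by rewrite -[_ \in _]/(i \in (supp f : seq nat)) e.
rewrite -[_ \in _]/(_ \in (supp f : seq nat)).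
elim: (supp f : seq nat) => // x [|y s] IH _.
  by rewrite big_seq1 mem_seq1.
rewrite big_cons /=; case: (leqP x (\max_(i <- y :: s) i)%N) => _.
  by rewrite inE IH ?orbT.
by rewrite inE eqxx.
Qed.

Definition Omega_set (I : rb_ideal lam) (j : nat) : set k :=
  [set 0] `|`
  [set b | exists f : A, [/\ I f, f <> 0 & in_term f = b *: rba lam j]].

Lemma Omega_setE (I : rb_ideal lam) j b : Omega_set I j b <->
  exists f : A, [/\ I f, coef f j = b & forall i, (j < i)%N -> coef f i = 0].
Proof.
split=> [[->|[f [If f0 e]]]|[f [If fj fi]]].
- by exists 0; split=> //; apply: submod0.
- have nz := coef_deg f0; have := congr1 (fun g : A => coef g (deg f)) e.
  rewrite /in_term !coefZ !coef_a eqxx mulr1.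
  case: eqP => [dj|_]; last by rewrite mulr0.
  rewrite mulr1 dj => fb; exists f; split=> // i; rewrite -dj; exact: coef_gt_deg.
- have [b0|b0] := pselect (b = 0); [by left | right; exists f].
  have f0 : f <> 0 by move=> f0; apply: b0; rewrite -fj f0.
  suff dj : deg f = j by rewrite /in_term dj fj.
  apply/eqP; rewrite eqn_leq; apply/andP; split.
    by rewrite leqNgt; apply/negP => /fi; apply: coef_deg.
  by rewrite leqNgt; apply/negP => /coef_gt_deg; rewrite fj.
Qed.

Program Definition Omega (I : rb_ideal lam) (j : nat) : ideal k :=
  @Submod k k^o (Omega_set I j) _ _.
Next Obligation. by move=> I j; left. Qed.
Next Obligation.
move=> I j c x y /Omega_setE[f [If fj fi]] /Omega_setE[g [Ig gj gi]].
apply/Omega_setE; exists (c *: f + g); split; first exact: submodP.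
  by rewrite coefD coefZ fj gj.
by move=> i ji; rewrite coefD coefZ fi // gi // mulr0 addr0.
Qed.

(* Omega_(t-1), with Omega_(-1) = 0 *)
Definition Omega_pred (I : rb_ideal lam) (t : nat) : set k :=
  if t is t'.+1 then Omega_set I t' else [set 0].

Definition jumps (I : rb_ideal lam) : set nat :=
  [set t | Omega_pred I t `<` Omega_set I t].

End RBIdeals.

(* Elements of N together with infinity, the latter being None. *)
Definition xnat := option nat.

Definition le_x (n : nat) (m : xnat) : bool := if m is Some m' then (n <= m')%N else true.
Definition lt_x (n : nat) (m : xnat) : bool := if m is Some m' then (n < m')%N else true.
Definition x_le (m : xnat) (n : nat) : bool := if m is Some m' then (m' <= n)%N else false.

Definition xcard (S : set nat) : xnat :=
  if pselect (finite_set S) then Some #|` fset_set S| else None.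

Definition xmin (S : set nat) : xnat :=
  if pselect (exists n, `[< S n >]) is left h then Some (ex_minn h) else None.

Definition in_range (N : xnat) (j : nat) : bool := (0 < j)%N && le_x j N.

Section AscentSet.
Variables (k : comPzRingType) (lam : k).
Implicit Type I : rb_ideal lam.

Definition N_ I : xnat := xcard (jumps I).

(* s_j for j >= 1 is the j-th smallest jump, infinity if there is none; by
   convention s_0 = 0, which need not be a jump. *)
Fixpoint s_ I (j : nat) : xnat :=
  match j with
  | 0 => Some 0%N
  | 1 => xmin (jumps I)
  | j'.+1 => if s_ I j' is Some t then xmin [set u | jumps I u /\ (t < u)%N]
             else None
  end.

(* Omega_(s_j), with Omega_(s_0) = 0; the value at s_j = infinity is junk. *)
Definition Omega_s I (j : nat) : ideal k :=
  if j is 0 then zero_submod k^o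
  else if s_ I j is Some t then Omega I t else zero_submod k^o.

Definition ascent_set I : set (nat * ideal k) :=
  [set p | exists2 j, in_range (N_ I) j & s_ I j = Some p.1 /\ p.2 = Omega_s I j].

(* The index pairs (j, i) with s_j <= i < s_(j+1), for j in [N_I], resp. for
   0 <= j <= N_I. *)
Definition steps1 I : set (nat * nat) :=
  [set p | [/\ in_range (N_ I) p.1, x_le (s_ I p.1) p.2 & lt_x p.2 (s_ I p.1.+1)]].
Definition steps0 I : set (nat * nat) :=
  [set p | [/\ le_x p.1 (N_ I), x_le (s_ I p.1) p.2 & lt_x p.2 (s_ I p.1.+1)]].

End AscentSet.

(* The condition on W 1 is the strict inclusion Omega_(s_0) = 0 of the first
   ideal; without it the set would contain values that no ascent set takes. *)
Definition ascending_pairs (k : comPzRingType) : set (set (nat * ideal k)) :=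
  [set X | exists (N : xnat) (s : nat -> nat) (W : nat -> ideal k),
    [/\ in_range N 1,
        [set 0] `<` submod_set (W 1%N),
        forall j, in_range N j -> in_range N j.+1 ->
          (s j < s j.+1)%N /\ submod_set (W j) `<` submod_set (W j.+1) &
        X = [set p | exists2 j, in_range N j & p = (s j, W j)]]].

(* Main.v *)
(* An increasing sequence of ideals W_i gives the homogeneous Rota-Baxter ideal
   of all x whose i-th coefficient lies in W_i for every i, because a_m a_n only
   involves indices at least max(m,n).  Conversely a homogeneous I is of this
   form with W_i = {b | b a_i in I}, as this ideal lies in I and contains the
   homogeneous generators of I; then W_i = Omega_i.  Hence x is in I iff each of
   its coefficients is in the corresponding Omega_i, which gives both direct
   sums, and I is determined by i |-> Omega_i, i.e. by the jumps and the ideals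
   at the jumps.  The position of i among the jumps is read off the number c of
   jumps t <= i: then s_c <= i < s_(c+1) and Omega_i = Omega_(s_c). *)
Require Import Defs.
From HB Require Import structures.
From mathcomp Require Import all_boot all_order all_algebra.
From mathcomp Require Import finmap.
From mathcomp Require Import mathcomp_extra boolp classical_sets functions.
From mathcomp Require Import cardinality fsbigop zify.

Set Implicit Arguments.
Unset Strict Implicit.
Unset Printing Implicit Defensive.

Import GRing.Theory.
Local Open Scope classical_set_scope.
Local Open Scope ring_scope.
#[local] Obligation Tactic := idtac.

(** * Least elements and counting functions of sets of natural numbers *)

Lemma xminP (S : set nat) n :
  xmin S = Some n <-> S n /\ forall m, (m < n)%N -> ~ S m.
Proof.
rewrite /xmin; case: pselect => [h|h]; last first.
  by split=> // -[Sn _]; case: h; exists n; apply/asboolP.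
case: ex_minnP => m /asboolP Sm mmin; split=> [[<-]|[Sn nmin]].
  by split=> // l lm /asboolP /mmin; rewrite leqNgt lm.
have mn : (m <= n)%N by apply: mmin; apply/asboolP.
suff -> : m = n by [].
by apply/eqP; rewrite eqn_leq mn leqNgt; apply/negP => /nmin.
Qed.

Section CountBelow.
Variable S : set nat.

Definition count_below (n : nat) : nat := #|` fset_set (S `&` `I_n)|.

Let fin_below n : finite_set (S `&` `I_n).
Proof. by apply: sub_finite_set (finite_II n) => t []. Qed.

Lemma count_below0 : count_below 0 = 0%N.
Proof. by rewrite /count_below II0 setI0 fset_set0 cardfs0. Qed.

Lemma count_belowS n : count_below n.+1 = (count_below n + `[< S n >])%N.
Proof.
rewrite /count_below; case: asboolP => Sn /=.
  have -> : S `&` `I_n.+1 = n |` (S `&` `I_n).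
    apply/seteqP; split=> t /=; last by case=> [->|[St tn]]; split=> //; lia.
    by move=> [St]; rewrite ltnS leq_eqVlt => /orP[/eqP->|]; [left | right].
  have nS : n \notin fset_set (S `&` `I_n).
    by rewrite in_fset_set //; apply/negP => /set_mem /= []; rewrite ltnn.
  by rewrite fset_setU1 // cardfsU1 nS addnC.
rewrite addn0; congr (#|` fset_set _|); apply/seteqP; split=> t /= [St].
  rewrite ltnS leq_eqVlt => /orP[/eqP tn|//]; by rewrite tn in St.
by split=> //; lia.
Qed.

Lemma count_below_le m n : (m <= n)%N -> (count_below m <= count_below n)%N.
Proof.
move=> mn; apply/fsubset_leq_card; rewrite -fset_set_sub //.
by move=> t /= [St tm]; split=> //; apply: leq_trans mn.
Qed.

Lemma count_below_lt m n : S m -> (m < n)%N -> (count_below m < count_below n)%N.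
Proof.
move=> Sm mn; apply: leq_trans (count_below_le mn).
by rewrite count_belowS asboolT ?addn1.
Qed.

Lemma count_below_gap m n : (m <= n)%N ->
  (forall t, (m <= t < n)%N -> ~ S t) -> count_below n = count_below m.
Proof.
move=> mn gap; rewrite /count_below; congr (#|` fset_set _|).
apply/seteqP; split=> t /= [St] h; split=> //; last by lia.
by rewrite ltnNge; apply/negP => mt; apply: (gap t) => //; rewrite mt.
Qed.

(** Discrete intermediate value principle: the count rises by at most one per step, and only just
    after an element of [S]. It supplies the element of [S] of any given rank, ranks starting at
    0. *)
Lemma lt_count_below n j : (j < count_below n)%N ->
  exists t, [/\ (t < n)%N, S t & count_below t = j].
Proof.
elim: n => [|n IH]; first by rewrite count_below0.
have [/IH[t [tn St ct]] _|cj] := ltnP j (count_below n).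
  by exists t; split=> //; apply: ltnW.
rewrite count_belowS; case: asboolP => Sn /=; last by lia.
by move=> ?; exists n; split=> //; lia.
Qed.

(** Treats finite and infinite [S] alike: cardinality becomes a statement about initial segments. *)
Lemma le_x_xcard j : le_x j (xcard S) <-> exists n, (j <= count_below n)%N.
Proof.
rewrite /xcard; case: pselect => /= finS.
  split=> [jS|[n jn]]; last first.
    by apply: leq_trans jn _; apply/fsubset_leq_card; rewrite -fset_set_sub// => t [].
  (* Initial segments exclude their endpoint, hence the successor of the maximum. *)
  exists (\max_(t <- fset_set S) t).+1; apply: leq_trans jS _.
  apply/fsubset_leq_card; rewrite -fset_set_sub // => t St; split=> //=.
  rewrite ltnS; apply: (@leq_bigmax_seq _ _ xpredT id) => //.
  by rewrite in_fset_set //; apply/mem_set.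
split=> // _; elim: j => [|j [n jn]]; first by exists 0%N.
(* If the count never exceeded j, no element of [S] could lie at or above n, and [S] would be
   finite. *)
apply: contrapT => bounded; apply: finS.
apply: sub_finite_set (finite_II n) => t St /=; rewrite ltnNge; apply/negP => nt.
apply: bounded; exists t.+1; apply: leq_ltn_trans (count_below_lt St (ltnSn t)).
exact: leq_trans jn (count_below_le nt).
Qed.

End CountBelow.

(** * Position of an index among the jumps of an ideal *)

Section Jumps.
Variables (k : comPzRingType) (lam : k) (I : rb_ideal lam).
Local Notation count := (count_below (jumps I)).

(** Replaces the recursive enumeration by a rank condition. The index shifts by one because [s_]
    numbers jumps from 1, while [count t] omits t itself. *)
Lemma s_S j t : s_ I j.+1 = Some t <-> jumps I t /\ count t = j.
Proof.
elim: j t => [|j IH] t.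
  rewrite [s_ _ _]/(xmin _) xminP; split=> -[Jt h]; split=> //.
    by rewrite (@count_below_gap _ 0) ?count_below0 // => u /andP[_ /h].
  by move=> m mt Jm; have := count_below_lt Jm mt; rewrite h.
rewrite (_ : s_ I j.+2 = if s_ I j.+1 is Some u
  then xmin [set v | jumps I v /\ (u < v)%N] else None) //; split.
  case e : (s_ I j.+1) => [u|//]; move/IH: e => [Ju cu] /xminP[[Jt ut] tmin].
  split=> //; rewrite -cu (@count_below_gap _ u.+1) //.
    by rewrite count_belowS asboolT ?addn1.
  by move=> v /andP[uv /tmin nv] Jv; apply: nv.
move=> [Jt ct]; have [u [ut Ju cu]] : exists u, [/\ (u < t)%N, jumps I u & count u = j].
  by apply: lt_count_below; rewrite ct.
have -> : s_ I j.+1 = Some u by apply/IH.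
(* A jump m strictly between u and t would force j = count u < count m < count t = j + 1. *)
apply/xminP; split=> // m mt [Jm um].
have := count_below_lt Ju um; have := count_below_lt Jm mt; lia.
Qed.

(** A Galois connection that turns inequalities on the s_j, infinite values included, into
    arithmetic on counts. Taking [i.+1] includes a possible jump at i. *)
Lemma x_le_s j i : x_le (s_ I j) i = (j <= count i.+1)%N.
Proof.
case: j => [//|j]; apply/idP/idP.
  case e : (s_ I j.+1) => [t|//] /= ti; move/s_S: e => [Jt <-].
  exact: count_below_lt.
move/lt_count_below => [t [ti Jt ct]].
by have -> : s_ I j.+1 = Some t by apply/s_S.
Qed.

Lemma lt_x_s j i : lt_x i (s_ I j) = (count i.+1 < j)%N.
Proof. by rewrite ltnNge -x_le_s; case: (s_ I j) => //= t; rewrite ltnNge. Qed.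

Lemma le_x_count n : le_x (count n) (N_ I).
Proof. by apply/le_x_xcard; exists n. Qed.

(** The index pairs are the graph of a function of i, so each basis index lies in exactly one
    block. *)
Lemma steps0P p : steps0 I p <-> p.1 = count p.2.+1.
Proof.
rewrite /steps0 /mkset x_le_s lt_x_s; split=> [[_ h1 h2]|e]; first by lia.
by rewrite e le_x_count; split; lia.
Qed.

Lemma steps1P p : steps1 I p <-> p.1 = count p.2.+1 /\ (0 < count p.2.+1)%N.
Proof.
rewrite /steps1 /mkset /in_range x_le_s lt_x_s.
split=> [[/andP[p0 _] h1 h2]|[e c0]]; first by lia.
by rewrite e le_x_count c0; split; lia.
Qed.

End Jumps.

(** * Ideals given by conditions on coefficients, and homogeneous ideals *)

Lemma submod_eq (k : pzRingType) (V : lmodType k) (S T : submod V) :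
  (forall x, S x <-> T x) -> S = T.
Proof.
case: S T => [S S0 SP] [T T0 TP] ST.
have e : S = T by apply/seteqP; split=> x; apply ST.
by subst T; congr Submod; apply: Prop_irrelevance.
Qed.

Lemma submod_sum (k : pzRingType) (V : lmodType k) (S : submod V)
    (J : eqType) (r : seq J) (F : J -> V) :
  (forall j, j \in r -> S (F j)) -> S (\sum_(j <- r) F j).
Proof.
move=> SF; rewrite big_seq; elim/big_rec: _ => [|j x jr Sx]; first exact: submod0.
by rewrite -[F j]scale1r; apply: submodP => //; apply: SF.
Qed.

Section Ideals.
Variables (k : comPzRingType) (lam : k).
Local Notation A := (RB lam).
Implicit Type I : rb_ideal lam.

Lemma rb_ideal_eq (I J : rb_ideal lam) : (forall x, I x <-> J x) -> I = J.
Proof.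
case: I J => [S SM SP] [T TM TP] /= /submod_eq ST; subst T.
by congr RBIdeal; apply: Prop_irrelevance.
Qed.

Lemma submod_linext (V : lmodType k) (S : submod V) (g : nat -> V) (x : A) :
  (forall m, S (coef x m *: g m)) -> S (linext g x).
Proof.
move=> Sg; rewrite (@linextE _ _ _ g x (supp x)); last exact: coef_out.
exact: submod_sum.
Qed.

Section AscIdeal.
Variable W : nat -> ideal k.
Hypothesis W_asc : forall i b, W i b -> W i.+1 b.

Lemma asc_le i j b : (i <= j)%N -> W i b -> W j b.
Proof.
by move=> /subnK <-; elim: (j - i)%N => // n IH /IH; rewrite addSn; apply: W_asc.
Qed.

Program Definition asc_submod : submod A :=
  @Submod k A [set x : A | forall i, W i (coef x i)] _ _.
Next Obligation. by move=> i; apply: submod0. Qed.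
Next Obligation.
move=> c x y Wx Wy i; rewrite Defs.coefD Defs.coefZ.
by apply: (@submodP _ _ (W i) c); [apply: Wx | apply: Wy].
Qed.

Lemma asc_submod_rba b i j : (i <= j)%N -> W i b -> asc_submod (b *: rba lam j).
Proof.
move=> ij Wb l; rewrite Defs.coefZ coef_a; case: eqP => [->|_].
  by rewrite mulr1; apply: asc_le Wb.
by rewrite mulr0; apply: submod0.
Qed.

(** In a_m a_n only the indices m + n - i with i <= m occur; they are at least n, so a coefficient
    taken from [W n] stays admissible there. *)
Lemma asc_submod_mul (x y : A) : asc_submod y -> asc_submod (x * y).
Proof.
move=> Wy; apply: submod_linext => m; apply: submodZ; apply: submod_linext => n.
rewrite /mul_basis scaler_sumr; apply: submod_sum => -[i hi] _.
rewrite scalerA; apply: (@asc_submod_rba _ n); first by rewrite /=; lia.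
by rewrite mulrC; apply: (@submodZ _ _ (W n)); apply: Wy.
Qed.

Lemma asc_submod_P (x : A) : asc_submod x -> asc_submod (rbP x).
Proof.
by move=> Wx; apply: submod_linext => m; apply: (@asc_submod_rba _ m).
Qed.

Definition asc_ideal : rb_ideal lam := RBIdeal asc_submod_mul asc_submod_P.

(** All homogeneous elements of the ideal serve as generators: each term of the basis expansion of a
    member is again a member. *)
Lemma asc_ideal_homogeneous : homogeneous asc_ideal.
Proof.
exists [set x | homogeneous_elt x /\ asc_ideal x]; split; first by move=> x [].
split=> [x []//|J GJ x Wx].
rewrite (rba_expand x); apply: submod_linext => m; apply: GJ; split.
  by exists (coef x m), m.
by apply: (@asc_submod_rba _ m) => //; apply: Wx.
Qed.

Lemma Omega_asc_ideal i b : Omega asc_ideal i b <-> W i b.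
Proof.
split=> [/Omega_setE[f [Wf <- _]]|Wb]; first exact: Wf.
apply/Omega_setE; exists (b *: rba lam i); split; first exact: (@asc_submod_rba _ i).
  by rewrite Defs.coefZ coef_a eqxx mulr1.
by move=> l il; rewrite Defs.coefZ coef_a gtn_eqF // mulr0.
Qed.

End AscIdeal.

(** The operator P shifts coefficients up by one, so it moves a leading coefficient from degree i to
    degree i + 1. *)
Lemma Omega_S I i b : Omega I i b -> Omega I i.+1 b.
Proof.
move=> /Omega_setE[f [If fi hi]]; apply/Omega_setE; exists (rbP f).
have fE : linext (rba lam) f = \sum_(m <- supp f) coef f m *: rba lam m.
  by apply: linextE; apply: coef_out.
have cP j : coef (rbP f) j.+1 = coef f j.
  rewrite [in RHS](rba_expand f) fE.
  rewrite /rbP (@linextE _ _ _ _ f (supp f)); last exact: coef_out.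
  rewrite !Defs.coef_sum; apply: eq_bigr => m _.
  by rewrite !Defs.coefZ !coef_a eqSS.
split; [exact: rbi_P|by rewrite cP|].
by case=> // j ij; rewrite cP hi.
Qed.

Program Definition homog_part I (i : nat) : ideal k :=
  @Submod k k^o [set b | I (b *: rba lam i)] _ _.
Next Obligation. by move=> I i; rewrite /mkset scale0r; apply: submod0. Qed.
Next Obligation.
by move=> I i c x y /= Ix Iy; rewrite scalerDl -scalerA; apply: submodP.
Qed.

Lemma homog_part_S I i b : homog_part I i b -> homog_part I i.+1 b.
Proof. by move/(@rbi_P _ _ I); rewrite linearZ /= rbP_a. Qed.

Lemma homogeneous_mem I : homogeneous I ->
  forall x, I x <-> forall i, Omega I i (coef x i).
Proof.
move=> [G [Ghom [GI Gmin]]].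
(* One inclusion is the basis expansion; the other is minimality of I among the Rota-Baxter ideals
   containing its generators. *)
have IE : I = asc_ideal (@homog_part_S I).
  apply: rb_ideal_eq => x; split=> [Ix|Wx]; last first.
    by rewrite (rba_expand x); apply: submod_linext => m; apply: Wx.
  apply: (Gmin (asc_ideal (@homog_part_S I))) Ix => y Gy.
  have [b [m ye]] := Ghom _ Gy; rewrite ye.
  by apply: (@asc_submod_rba _ (@homog_part_S I) _ m) => //; have := GI _ Gy; rewrite ye.
move=> x; rewrite IE; split=> h i; first by apply/Omega_asc_ideal; apply: h.
by have /Omega_asc_ideal := h i.
Qed.

End Ideals.

(** * The ascent set and its injectivity on homogeneous ideals *)

Section Ascent.
Variables (k : comPzRingType) (lam : k).
Local Notation A := (RB lam).
Implicit Type I : rb_ideal lam.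
Local Notation count I := (count_below (jumps I)).

Lemma Omega_le I i j b : (i <= j)%N -> Omega I i b -> Omega I j b.
Proof. exact: (asc_le (@Omega_S _ _ I)). Qed.

Lemma Omega_pred0 I t : Omega_pred I t 0.
Proof. by case: t => //= t; apply: (@submod0 _ _ (Omega I t)). Qed.

Lemma Omega_predW I t b : Omega_pred I t b -> Omega I t b.
Proof. by case: t => [->|t]; [apply: submod0 | apply: Omega_S]. Qed.

Lemma jumpsP I t : jumps I t <-> exists2 b, Omega I t b & ~ Omega_pred I t b.
Proof.
split=> [[_ /existsNP[b /not_implyP[Ob nb]]]|[b Ob nb]]; first by exists b.
by split=> [c /Omega_predW //|h]; apply: nb; apply: h.
Qed.

Lemma Omega_sE I j t : s_ I j.+1 = Some t -> Omega_s I j.+1 = Omega I t.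
Proof. by rewrite /Omega_s => ->. Qed.

(** Induction on i: at a jump, i is itself the jump numbered [count I i.+1]; otherwise neither the
    count nor [Omega] changes. Before the first jump both sides are zero. *)
Lemma Omega_s_count I i : Omega_s I (count I i.+1) = Omega I i.
Proof.
elim: i => [|i IH]; rewrite count_belowS; case: asboolP => Ji.
- by rewrite addn1; apply: Omega_sE; apply/s_S.
- rewrite count_below0; apply: submod_eq => b; split=> [->|Ob]; first exact: submod0.
  by apply: contrapT => b0; apply: Ji; apply/jumpsP; exists b.
- by rewrite addn1; apply: Omega_sE; apply/s_S.
- rewrite addn0 IH; apply: submod_eq => b; split=> [|Ob]; first exact: Omega_S.
  by apply: contrapT => b0; apply: Ji; apply/jumpsP; exists b.
Qed.

(** Removes the numbering: the ascent set is the graph of [Omega] over the jumps. *)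
Lemma ascent_setP I p : ascent_set I p <-> jumps I p.1 /\ p.2 = Omega I p.1.
Proof.
split=> [[[//|j] _ [sj Oj]]|[Jp Op]].
  by split; [case/s_S: sj | apply: etrans Oj (Omega_sE sj)].
have sp : s_ I (count I p.1).+1 = Some p.1 by apply/s_S.
exists (count I p.1).+1; last by split=> //; rewrite (Omega_sE sp).
rewrite /in_range /= le_x_xcard; exists p.1.+1.
by rewrite count_belowS asboolT ?addn1.
Qed.

(** Reconstructs every [Omega I i] from the ascent set alone, which is what makes the map injective
    on homogeneous ideals. The alternative [b = 0] covers indices before the first jump. *)
Lemma Omega_ascent_set I i b : Omega I i b <->
  b = 0 \/ exists p, [/\ ascent_set I p, (p.1 <= i)%N & p.2 b].
Proof.
split=> [|[->|[p [/ascent_setP[_ ->]]]]]; [|exact: submod0|exact: Omega_le].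
rewrite -Omega_s_count; case e : (count I i.+1) => [|j]; first by left.
have [t [ti Jt ct]] : exists t, [/\ (t < i.+1)%N, jumps I t & count I t = j].
  by apply: lt_count_below; rewrite e.
have sj : s_ I j.+1 = Some t by apply/s_S.
rewrite (Omega_sE sj) => Ob; right; exists (t, Omega I t); split=> //.
exact/ascent_setP.
Qed.

Lemma homogeneous_ascent_inj I J :
  homogeneous I -> homogeneous J -> ascent_set I = ascent_set J -> I = J.
Proof.
move=> hI hJ e; apply: rb_ideal_eq => x.
rewrite (homogeneous_mem hI) (homogeneous_mem hJ).
by split=> h i; have := h i; rewrite !Omega_ascent_set e.
Qed.

Lemma s_in_range I j : in_range (N_ I) j -> exists2 t, s_ I j = Some t & jumps I t.
Proof.
case: j => // j; rewrite /in_range /= le_x_xcard => -[n /lt_count_below[t [_ Jt ct]]].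
by exists t => //; apply/s_S.
Qed.

Lemma ascent_set_ascending I : homogeneous I -> submod_set I <> [set 0] ->
  ascending_pairs (ascent_set I).
Proof.
(* The default 0 is never taken on the range, where [s_ I j] is finite. *)
move=> hI I0; exists (N_ I), (fun j => odflt 0%N (s_ I j)), (Omega_s I).
(* Without a jump every [Omega I i] would vanish, and homogeneity would give I = 0. *)
have r1 : in_range (N_ I) 1.
  apply: contrapT => nr; apply: I0; apply/seteqP; split=> x /=; last first.
    by move=> ->; apply: submod0.
  move=> Ix; apply: coefP => i; have /(homogeneous_mem hI)/(_ i) := Ix.
  rewrite -Omega_s_count; case e : (count I i.+1) => [//|j]; case: nr.
  by rewrite /in_range /= le_x_xcard; exists i.+1; rewrite e.
split=> //.
- have [t s1 Jt] := s_in_range r1; rewrite (Omega_sE s1).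
  move/jumpsP: Jt => [b Ob nb]; split=> [_ ->|h]; first exact: submod0.
  by apply: nb; rewrite (h _ Ob); apply: Omega_pred0.
- case=> // j rj rj1; have [t sj Jt] := s_in_range rj.
  have [u sj1 Ju] := s_in_range rj1; rewrite sj sj1 (Omega_sE sj) (Omega_sE sj1) /=.
  have tu : (t < u)%N.
    rewrite ltnNge; apply/negP => /(count_below_le (jumps I)).
    by move/s_S: sj => [_ ->]; move/s_S: sj1 => [_ ->]; rewrite ltnn.
  split=> //; split=> [b|h]; first exact: Omega_le (ltnW tu).
  (* Strictness: t < u makes u a successor whose predecessor is at least t, so equality with the
     ideal at t would contradict the jump at u. *)
  move/jumpsP: Ju => [b Ob]; apply; case: u tu h {sj1} Ob => // u tu h Ob.
  by apply: (Omega_le (i := t)) => //; apply: h.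
- apply/seteqP; split=> -[t O] /=.
    by move=> [j rj [/= sj ->]]; exists j => //; rewrite sj.
  by move=> [j rj [-> ->]]; exists j => //=; have [u -> _] := s_in_range rj.
Qed.

(** * Realization of a sequence of ascending pairs by a homogeneous ideal *)

Section Realize.
Variables (N : xnat) (s : nat -> nat) (W : nat -> ideal k).
Hypothesis W1 : [set 0] `<` submod_set (W 1%N).
Hypothesis sW : forall j, in_range N j -> in_range N j.+1 ->
  (s j < s j.+1)%N /\ submod_set (W j) `<` submod_set (W j.+1).

Lemma in_range_le i j : (0 < i <= j)%N -> in_range N j -> in_range N i.
Proof.
by rewrite /in_range => /andP[-> ij] /andP[_]; case: N => //= n; apply: leq_trans.
Qed.

(** Iterates the hypothesis on consecutive indices. The summand [j - i] retains the strict growth of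
    [s], from which [s_le_inv] recovers the order of indices. *)
Lemma s_W_le i j : (0 < i <= j)%N -> in_range N j ->
  (s i + (j - i) <= s j)%N /\ submod_set (W i) `<=` submod_set (W j).
Proof.
move=> /andP[i0 /subnK <-]; elim: (j - i)%N => [|n IH]; first by rewrite add0n subnn addn0; split.
rewrite addSn => r; have r' : in_range N (n + i) by apply: in_range_le r; lia.
have [h1 h2] := IH r'; have [h3 [h4 _]] := sW r' r.
by split; [lia | apply: subset_trans h4].
Qed.

Lemma s_le_inv i j : in_range N i -> in_range N j -> (s i <= s j)%N -> (i <= j)%N.
Proof.
move=> ri rj; case: (leqP i j) => // ji sij.
have [h _] : (s j + (i - j) <= s i)%N /\ submod_set (W j) `<=` submod_set (W i).
  by apply: s_W_le => //; case/andP: rj => -> _; apply: ltnW.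
by lia.
Qed.

(** An element missing from the preceding ideal is missing from all earlier ones, since they form a
    chain; for j = 1 it is a nonzero element of the first ideal. *)
Lemma W_new j : in_range N j -> exists b, [/\ W j b, b <> 0 &
  forall i, in_range N i -> (i < j)%N -> ~ W i b].
Proof.
case: j => // -[|j] rj.
  case: W1 => _ /existsNP[b /not_implyP[Wb b0]]; exists b; split=> // -[]//.
have rj' : in_range N j.+1 by apply: in_range_le rj; lia.
have [_ [_ /existsNP[b /not_implyP[Wb b0]]]] := sW rj' rj.
exists b; split=> //; first by move=> e; apply: b0; rewrite e; apply: submod0.
move=> i ri ij Wi; apply: b0; have [_] : (s i + (j.+1 - i) <= s j.+1)%N /\
  submod_set (W i) `<=` submod_set (W j.+1); last exact.
by apply: s_W_le => //; case/andP: ri => ->.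
Qed.

(** A union instead of a choice of the last j with [s j <= i]; the alternative [b = 0] gives the
    zero ideal when there is no such j. Closure under sums holds because the [W j] form a chain. *)
Program Definition step_ideal (i : nat) : ideal k := @Submod k k^o
  [set b | b = 0 \/ exists j, [/\ in_range N j, (s j <= i)%N & W j b]] _ _.
Next Obligation. by left. Qed.
Next Obligation.
have Wmono j l b : in_range N j -> in_range N l -> (j <= l)%N -> W j b -> W l b.
  move=> /andP[j0 _] rl jl; have jl' : (0 < j <= l)%N by rewrite j0.
  by have [_] := s_W_le jl' rl; apply.
move=> i c x y [->|[j [rj sj Wx]]] [->|[l [rl sl Wy]]].
- by left; rewrite scaler0 addr0.
- by right; exists l; split=> //; rewrite scaler0 add0r.
- by right; exists j; split=> //; rewrite addr0; apply: submodZ.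
- right; have [jl|lj] := leqP j l.
    by exists l; split=> //; apply: submodP => //; apply: Wmono Wx.
  by exists j; split=> //; apply: submodP => //; apply: (Wmono l) => //; apply: ltnW.
Qed.

Lemma step_ideal_S i b : step_ideal i b -> step_ideal i.+1 b.
Proof.
move=> [->|[j [rj sj Wb]]]; [by left | right; exists j; split=> //].
exact: leqW.
Qed.

Lemma step_ideal_s j : in_range N j -> step_ideal (s j) = W j.
Proof.
move=> rj; apply: submod_eq => b; split=> [|Wb]; last by right; exists j.
move=> [->|[i [ri sij]]]; first exact: submod0.
have ij : (0 < i <= j)%N by rewrite (s_le_inv ri rj sij) andbT; case/andP: ri.
by have [_] := s_W_le ij rj; apply.
Qed.

Lemma ascent_set_realize :
  ascent_set (asc_ideal lam step_ideal_S) =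
  [set p | exists2 j, in_range N j & p = (s j, W j)].
Proof.
set I := asc_ideal _ _.
have OE i : Omega I i = step_ideal i.
  by apply: submod_eq => b; apply: Omega_asc_ideal.
have predE t b : Omega_pred I t b <->
    b = 0 \/ exists j, [/\ in_range N j, (s j < t)%N & W j b].
  case: t => [|t] /=; first by split=> [|[//|[j []]]//]; left.
  by rewrite -[Omega_set I t b]/(Omega I t b) OE.
(* An element new at t comes from some [W j] with [s j <= t], and [s j < t] would make it old;
   conversely [W_new] gives an element that first appears at [s j]. *)
have JE t : jumps I t <-> exists2 j, in_range N j & s j = t.
  rewrite jumpsP OE; split=> [[b Ob nb]|[j rj <-]].
    move: Ob => [b0|[j [rj sj Wb]]]; first by case: nb; apply/predE; left.
    exists j => //; apply/eqP; rewrite eqn_leq sj leqNgt; apply/negP => sjt.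
    by apply: nb; apply/predE; right; exists j.
  have [b [Wb b0 nb]] := W_new rj; exists b; first by rewrite step_ideal_s.
  move/predE => [//|[i [ri sij Wi]]]; apply: (nb i) => //.
  rewrite ltn_neqAle (s_le_inv ri rj (ltnW sij)) andbT.
  by apply/eqP => e; rewrite e ltnn in sij.
apply/seteqP; split=> -[t O] /=.
  move=> /ascent_setP /= [/JE[j rj <-] ->]; exists j => //.
  by rewrite OE step_ideal_s.
move=> [j rj [-> ->]]; apply/ascent_setP => /=; split; first by apply/JE; exists j.
by rewrite OE step_ideal_s.
Qed.

End Realize.

Lemma ascending_pairs_realized (X : set (nat * ideal k)) : ascending_pairs X ->
  exists2 I : rb_ideal lam, homogeneous I & ascent_set I = X.
Proof.
move=> [N [s [W [_ W1 sW ->]]]]; exists (asc_ideal lam (@step_ideal_S N s W sW)).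
  exact: asc_ideal_homogeneous.
exact: ascent_set_realize.
Qed.

End Ascent.

(** * A criterion for internal direct sums of graded pieces *)

Section GradedSum.
Variables (k : comPzRingType) (lam : k) (T : choiceType) (D : set T) (idx : T -> nat).
Local Notation A := (RB lam).
Hypothesis idx_inj : {in D &, injective idx}.

(** By injectivity of [idx], at most one term contributes to any given coefficient. *)
Lemma coef_graded_sum (f : T -> A) :
  (forall t i, D t -> i != idx t -> coef (f t) i = 0) ->
  finite_set (D `&` [set t | f t <> 0]) ->
  (forall t, D t -> coef (\sum_(u \in D) f u) (idx t) = coef (f t) (idx t)) /\
  (forall i, ~ (idx @` D) i -> coef (\sum_(u \in D) f u) i = 0).
Proof.
move=> f_graded finf; set B := fset_set (D `&` [set t | f t <> 0]).
have -> : \sum_(u \in D) f u = \sum_(u <- B) f u.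
  by rewrite fsbig_supp fsbig_finite.
have BP u : u \in B -> D u by rewrite in_fset_set // => /set_mem[].
split=> [t Dt|i Di]; rewrite Defs.coef_sum; last first.
  rewrite big_seq big1 // => u /BP Du; apply: f_graded => //.
  by apply/eqP => e; apply: Di; exists u.
have other u : u \in B -> u != t -> coef (f u) (idx t) = 0.
  move=> /BP Du ut; apply: f_graded => //; apply: contra ut => /eqP e.
  by apply/eqP/idx_inj; rewrite ?inE.
have [tB|tB] := boolP (t \in B).
  rewrite (big_fsetD1 t) //= big_seq big1 ?addr0 // => u.
  by rewrite in_fsetD1 => /andP[ut uB]; apply: other.
have ft : f t = 0.
  apply: contrapT => ft; move/negP: tB; apply.
  by rewrite in_fset_set //; apply/mem_set.
rewrite ft big_seq big1 // => u uB; apply: other => //.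
by apply: contraNneq tB => <-.
Qed.

(** Abstract index types let one criterion serve both decompositions, with [idx] the identity on
    natural numbers or the second projection on pairs. *)
Lemma is_dsum_graded (K : T -> ideal k) (W : submod A) :
  (forall x, W x <-> (forall t, D t -> K t (coef x (idx t))) /\
                     (forall i, ~ (idx @` D) i -> coef x i = 0)) ->
  is_dsum D (fun t => ideal_mul (K t) (rba lam (idx t))) W.
Proof.
move=> WE.
have graded (f : T -> A) :
    (forall t, D t -> ideal_mul (K t) (rba lam (idx t)) (f t)) ->
    forall t i, D t -> i != idx t -> coef (f t) i = 0.
  move=> fK t i Dt /negPf it; have [c _ <-] := fK t Dt.
  by rewrite Defs.coefZ coef_a it mulr0.
split=> [x|f fK finf f0 t Dt]; last first.
  have [fD _] := coef_graded_sum (graded f fK) finf.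
  apply: coefP => i; have [->|it] := eqVneq i (idx t); last exact: graded it.
  by rewrite -fD // f0.
rewrite WE; split=> [[xK x0]|[f [fK finf ->]]]; last first.
  have [fD fN] := coef_graded_sum (graded f fK) finf; split=> // t Dt.
  rewrite fD //; have [c Kc <-] := fK t Dt.
  by rewrite Defs.coefZ coef_a eqxx mulr1.
pose f t := coef x (idx t) *: rba lam (idx t).
have fK t : D t -> ideal_mul (K t) (rba lam (idx t)) (f t).
  by move=> Dt; exists (coef x (idx t)) => //; apply: xK.
(* The map [idx] embeds the support of [f] in the finite support of [x]. *)
have finf : finite_set (D `&` [set t | f t <> 0]).
  have finx := @dsum_fin k nat (fun _ => k^o) x.
  have inj : {in D `&` [set t | f t <> 0] &, injective idx}.
    by move=> t u /set_mem[Dt _] /set_mem[Du _]; apply: idx_inj; apply/mem_set.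
  rewrite -(eq_finite_set (inj_card_eq inj)).
  apply: sub_finite_set finx => _ [t [Dt ft] <-] /= e; apply: ft.
  by rewrite /f [coef _ _]e scale0r.
exists f; split=> //.
have [fD fN] := coef_graded_sum (graded f fK) finf.
apply: coefP => i; have [[t Dt <-]|iD] := pselect ((idx @` D) i); last by rewrite x0 // fN.
by rewrite fD // Defs.coefZ coef_a eqxx mulr1.
Qed.

End GradedSum.

(** * The quotient as a direct sum of residue modules *)

Section Quotient.
Variables (k : comPzRingType) (lam : k) (I : rb_ideal lam).
Local Notation A := (RB lam).
Local Notation count := (count_below (jumps I)).
Local Notation M := (fun p : steps0 I => quotmod (Omega_s I (\val p).1) : lmodType k).

Lemma steps0_Omega (p : steps0 I) : Omega_s I (\val p).1 = Omega I (\val p).2.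
Proof. by have /steps0P -> := set_valP p; apply: Omega_s_count. Qed.

Lemma mem_steps0 i : (count i.+1, i) \in steps0 I.
Proof. by apply/mem_set/steps0P. Qed.

(** The inverse of the second projection on [steps0 I]; it transports finite supports between the
    two index sets. *)
Definition step_of (i : nat) : steps0 I :=
  exist (fun p => p \in steps0 I) _ (mem_steps0 i).

Lemma step_ofK (p : steps0 I) : step_of (\val p).2 = p.
Proof.
case: p => -[j i] ji; apply: val_inj => /=.
by have /steps0P /= -> := set_mem ji.
Qed.

Lemma residues_fin (x : A) :
  finite_set [set p : steps0 I | qpi (Omega_s I (\val p).1) (coef x (\val p).2) <> 0].
Proof.
have finx : finite_set (step_of @` [set i | coef x i <> 0]).
  exact: finite_image (@dsum_fin k nat (fun _ => k^o) x).
apply: sub_finite_set finx => p /= px; exists (\val p).2; last exact: step_ofK.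
by move=> e; apply: px; rewrite e linear0.
Qed.

Definition residues (x : A) : dsum M := @DSum k (steps0 I) M _ (residues_fin x).

Lemma residues_is_linear : linear residues.
Proof.
move=> c x y; apply: dsumP => p.
exact: (linearP (qpi (Omega_s I (\val p).1)) c (coef x (\val p).2) (coef y (\val p).2)).
Qed.
HB.instance Definition _ :=
  GRing.isLinear.Build k A (dsum M) *:%R residues residues_is_linear.

(* The case on [d p = 0] is needed for finite support: [repr 0] may be nonzero. *)
Lemma lift_fin (d : dsum M) : finite_set
  [set i | (if pselect (d (step_of i) = 0) then 0
            else repr (d (step_of i)) : k^o) <> 0].
Proof.
have inj : {in step_of @^-1` [set p | d p <> 0] &, injective step_of}.
  by move=> i j _ _ /(congr1 (fun p : steps0 I => (\val p).2)).
apply: sub_finite_set (finite_preimage inj (dsum_fin d)) => i /=.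
by case: pselect.
Qed.

Definition lift (d : dsum M) : A := @DSum k nat (fun _ => k^o) _ (lift_fin d).

(** Gives surjectivity: [lift] chooses a representative of each residue independently. *)
Lemma liftK d : residues (lift d) = d.
Proof.
apply: dsumP => p; rewrite -(step_ofK p); set i := (\val p).2.
rewrite [LHS]/(qpi _ (if pselect (d (step_of i) = 0) then 0 else repr (d (step_of i)))).
case: pselect => [e|ne] /=; last exact/esym/qpi_surj.
exact: etrans (linear0 (qpi _)) (esym e).
Qed.

Hypothesis I_homog : homogeneous I.

(** The kernel is computed coefficientwise: membership in a homogeneous I is tested by the ideals
    [Omega I i], and these are the ones divided out at the steps. *)
Lemma residues_eq (x y : A) : residues x = residues y <-> I (x - y).
Proof.
have coefB i : coef (x - y) i = coef x i - coef y i by [].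
rewrite (homogeneous_mem I_homog); split=> [e i|h].
  have /qpiE : qpi (Omega_s I (count i.+1)) (coef x i) =
               qpi (Omega_s I (count i.+1)) (coef y i).
    exact: (congr1 (fun d : dsum M => d (step_of i)) e).
  by rewrite Omega_s_count coefB.
by apply: dsumP => p; apply/qpiE; rewrite steps0_Omega -coefB.
Qed.

Definition quot_residues (q : quotmod I) : dsum M := residues (repr q).

Lemma quot_residues_pi (x : A) : quot_residues (qpi I x) = residues x.
Proof. by apply/residues_eq/qpiE; rewrite -qpi_surj. Qed.

Lemma quot_residues_is_linear : linear quot_residues.
Proof.
move=> c q r; rewrite (qpi_surj q) (qpi_surj r) -linearP !quot_residues_pi.
exact: linearP.
Qed.
HB.instance Definition _ := GRing.isLinear.Build k (quotmod I) (dsum M) *:%R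
  quot_residues quot_residues_is_linear.

Lemma quot_residues_bij : bijective quot_residues.
Proof.
have inj : injective quot_residues.
  move=> q r; rewrite (qpi_surj q) (qpi_surj r) !quot_residues_pi.
  by move/residues_eq/qpiE.
have K d : quot_residues (qpi I (lift d)) = d by rewrite quot_residues_pi liftK.
by exists (fun d => qpi I (lift d)) => // q; apply: inj; rewrite K.
Qed.

Lemma homogeneous_quotient : exists phi : {linear quotmod I -> dsum M},
  bijective phi /\
  forall (x : A) (p : steps0 I),
    phi (qpi I x) p = qpi (Omega_s I (\val p).1) (coef x (\val p).2).
Proof.
exists quot_residues; split; first exact: quot_residues_bij.
by move=> x p; rewrite [LHS]/(quot_residues (qpi I x) p) quot_residues_pi.
Qed.

End Quotient.

(** * Assembly of the decompositions, the quotient, uniqueness and the bijection *)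

Theorem theorem3p6 (k : comPzRingType) (lam : k) :
  (forall I : rb_ideal lam, homogeneous I ->
     is_dsum [set i | x_le (s_ I 1) i]
       (fun i => ideal_mul (Omega I i) (rba lam i)) I /\
     is_dsum (steps1 I)
       (fun p => ideal_mul (Omega_s I p.1) (rba lam p.2)) I) /\
  (forall I : rb_ideal lam, homogeneous I ->
     exists phi : {linear quotmod I ->
                     dsum (fun p : steps0 I => quotmod (Omega_s I (\val p).1))},
       bijective phi /\
       forall (x : RB lam) (p : steps0 I),
         phi (qpi I x) p = qpi (Omega_s I (\val p).1) (coef x (\val p).2)) /\
  (forall X : set (nat * ideal k), ascending_pairs X ->
     exists! I : rb_ideal lam, homogeneous I /\ ascent_set I = X) /\
  set_bij [set I : rb_ideal lam | homogeneous I /\ submod_set I <> [set 0]]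
    (@ascending_pairs k) (@ascent_set k lam).
Proof.
split=> [I hI|].
  (* Either i is at or past the first jump, or its component is zero; so the indices left out of
     both sums carry only zero coefficients. *)
  have OE i : (0 < count_below (jumps I) i.+1)%N \/ Omega I i = zero_submod k^o.
    have := Omega_s_count I i; case: (count_below _ _) => [<-|]; first by right.
    by left.
  split; apply: is_dsum_graded.
  - by move=> i j _ _.
  - move=> x; rewrite (homogeneous_mem hI).
    split=> [h|[h h0] i]; last first.
      have [D|nD] := pselect (x_le (s_ I 1) i); first exact: h.
      rewrite h0; first exact: submod0.
      by move=> [j jD ji]; apply: nD; rewrite -ji.
    split=> [i _|i nD]; first exact: h.
    have [c|O0] := OE i; last by have := h i; rewrite O0.
    by case: nD; exists i => //; rewrite /mkset x_le_s.
  - move=> [j i] [j' i'] /set_mem/steps1P[/= -> _] /set_mem/steps1P[/= -> _].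
    by move=> ->.
  - move=> x; rewrite (homogeneous_mem hI).
    split=> [h|[h h0] i].
      split=> [[j i] /steps1P[/= -> _]|i nD]; first by rewrite Omega_s_count.
      have [c|O0] := OE i; last by have := h i; rewrite O0.
      by case: nD; exists (count_below (jumps I) i.+1, i) => //; apply/steps1P.
    have [D|nD] := pselect (steps1 I (count_below (jumps I) i.+1, i)).
      by have := h _ D; rewrite Omega_s_count.
    rewrite h0; first exact: submod0.
    move=> [[j i'] /= D ii']; apply: nD; rewrite ii' in D.
    by have /steps1P[/= je _] := D; rewrite -je.
split; first exact: homogeneous_quotient.
split=> [X XA|].
  have [I hI IX] := ascending_pairs_realized lam XA.
  exists I; split=> // J [hJ JX]; apply: homogeneous_ascent_inj => //.
  by rewrite IX.
split=> [I [hI I0]|I J /set_mem[hI _] /set_mem[hJ _]|X XA].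
- exact: ascent_set_ascending.
- exact: homogeneous_ascent_inj.
(* The realized ideal is nonzero: its ascent set contains the first pair, and a jump requires a
   nonzero leading coefficient. *)
- have [I hI IX] := ascending_pairs_realized lam XA; exists I => //; split=> // I0.
  have [N [s [W [r1 [_ h] _ XE]]]] := XA.
  have : X (s 1%N, W 1%N) by rewrite XE; exists 1%N.
  rewrite -IX => /ascent_setP[/= /jumpsP[b /Omega_setE[f [If fb _]] nb] _].
  apply: nb; move: If; rewrite -fb /submod_pred I0 => ->; exact: Omega_pred0.
Qed.
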